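(* Assume the low-noise condition (LN) holds for some $c>0$. Let $X^*\in\mathbb{R}^{m_1\times m_2}$ satisfy $\|X^*\|_\infty\le\gamma$ and let $r=\operatorname{rank}(X^* )$. Let $\hat X^{(2)}\in\arg\max_{X\in K_{\max}(\gamma,r)}\ell_{\Omega,Y}(X)$ and $\hat\eta(\omega)=\operatorname{sign}(\hat X^{(2)}_\omega)$. Then $$\mathrm{excess}(\hat\eta,\eta^* )\le C_\gamma\sqrt{\frac{\operatorname{rank}(X^* )\,d}{n}},$$ where $C_\gamma>0$ is a constant depending only on $\gamma$ (and on the low-noise constant $c$).
   Context: Setup (1-bit matrix completion with logistic link). Let $m_1,m_2\ge1$, $d=m_1+m_2$, and let $f(x)=e^x/(1+e^x)$. An unknown matrix $X^*\in\mathbb{R}^{m_1\times m_2}$ is given. Indices $\omega_1,\dots,\omega_n$ are i.i.d. uniform on $[m_1]\times[m_2]$ (where $[k]=\{1,\dots,k\}$), $\Omega=(\omega_i)_{i=1}^n$, and, conditionally on the indices, the labels $Y_1,\dots,Y_n\in\{-1,1\}$ are independent with $Y_i=+1$ with probability $f(X^*_{\omega_i})$ and $Y_i=-1$ with probability $1-f(X^*_{\omega_i})$. The sample is $\mathcal S=\{(Y_i,\omega_i)\}_{i=1}^n$. Log-likelihood: $\ell_{\Omega,Y}(X)=\sum_{i=1}^n\big(\mathbf 1\{Y_i=1\}\log f(X_{\omega_i})+\mathbf 1\{Y_i=-1\}\log(1-f(X_{\omega_i}))\big)$. Norms: $\|X\|_\infty=\max_{i,j}|X_{ij}|$; $\|U\|_{2,\infty}$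 is the maximum Euclidean norm of the rows of $U$; the max-norm is $\|X\|_{\max}=\min_{X=UV^\top}\|U\|_{2,\infty}\|V\|_{2,\infty}$. For $\gamma,r>0$, $K_{\max}(\gamma,r)=\{X\in\mathbb{R}^{m_1\times m_2}:\|X\|_\infty\le\gamma,\ \|X\|_{\max}\le\gamma\sqrt r\}$. Classification risk: for a (possibly data-dependent) classifier $\eta:[m_1]\times[m_2]\to\{-1,1\}$, let $(Y,\omega)$ be a new pair independent of $\mathcal S$ with $\omega$ uniform on $[m_1]\times[m_2]$ and $Y\mid\omega$ equal to $+1$ with probability $f(X^*_\omega)$ and $-1$ otherwise; $R(\eta)=\mathbb P(Y\ne\eta(\omega)\mid\mathcal S)$. The Bayes classifier is $\eta^*(\omega)=\operatorname{sign}(X^*_\omega)$ (i.e. $+1$ iff $f(X^*_\omega)\ge1/2$, with $\operatorname{sign}(0)=+1$). For an estimator $\hat X$ the plug-in classifier is $\hat\eta(\omega)=\operatorname{sign}(\hat X_\omega)$ and $\mathrm{excess}(\hat\eta,\eta^* )=\mathbb E\,R(\hat\eta)-R(\eta^* )$, the expectation being over $\mathcal S$. Low-noise condition (LN): for some $c>0$, with $\omega$ uniform on $[m_1]\times[m_2]$, $\mathbb P\big(0<|f(X^*_\omega)-\tfrac12|<\tfrac1{2c}\big)=0$. *)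

(* Defs.v *)
From HB Require Import structures.
From mathcomp Require Import all_boot all_order all_algebra.
From mathcomp Require Import all_classical all_reals all_analysis.
Set Implicit Arguments. Unset Strict Implicit. Unset Printing Implicit Defensive.
Import Order.TTheory GRing.Theory Num.Theory.
Local Open Scope ring_scope.

Section Defs.
Variable R : realType.

Definition logistic (x : R) : R := expR x / (1 + expR x).

Definition norm_inf m1 m2 (X : 'M[R]_(m1, m2)) : R :=
  \big[Num.max/0]_(i < m1) \big[Num.max/0]_(j < m2) `|X i j|.

Definition norm_2inf m k (U : 'M[R]_(m, k)) : R :=
  \big[Num.max/0]_(i < m) Num.sqrt (\sum_(j < k) U i j ^+ 2).

(* max-norm: min (= inf, attained) over factorizations X = U V^T *)
Definition max_norm m1 m2 (X : 'M[R]_(m1, m2)) : R :=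
  inf [set t : R | exists (k : nat) (U : 'M[R]_(m1, k)) (V : 'M[R]_(m2, k)),
        X = U *m V^T /\ t = norm_2inf U * norm_2inf V].

Definition Kmax m1 m2 (gamma r : R) : set 'M[R]_(m1, m2) :=
  [set X | norm_inf X <= gamma /\ max_norm X <= gamma * Num.sqrt r].

(* a sample of size n: indices omega_i in [m1]x[m2] and labels Y_i,
   the boolean 'true' encoding Y_i = +1 and 'false' encoding Y_i = -1 *)
Definition sample m1 m2 n := {ffun 'I_n -> ('I_m1 * 'I_m2) * bool}.

Definition loglik m1 m2 n (S : sample m1 m2 n) (X : 'M[R]_(m1, m2)) : R :=
  \sum_(i < n) (if (S i).2 then ln (logistic (X (S i).1.1 (S i).1.2))
                else ln (1 - logistic (X (S i).1.1 (S i).1.2))).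

Definition label_prob m1 m2 (Xs : 'M[R]_(m1, m2)) (w : 'I_m1 * 'I_m2) (y : bool) : R :=
  if y then logistic (Xs w.1 w.2) else 1 - logistic (Xs w.1 w.2).

(* probability mass of a sample: omega_i i.i.d. uniform, labels conditionally
   independent *)
Definition sample_prob m1 m2 n (Xs : 'M[R]_(m1, m2)) (S : sample m1 m2 n) : R :=
  \prod_(i < n) ((m1 * m2)%:R^-1 * label_prob Xs (S i).1 (S i).2).

Definition unif_prob m1 m2 (A : pred ('I_m1 * 'I_m2)) : R :=
  #|[set w | A w]|%:R / (m1 * m2)%:R.

(* classifiers: eta w = true means +1, false means -1 *)
Definition classifier m1 m2 := 'I_m1 * 'I_m2 -> bool.

(* R(eta) = P(Y <> eta(omega)) for a fresh pair *)
Definition risk m1 m2 (Xs : 'M[R]_(m1, m2)) (eta : classifier m1 m2) : R :=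
  (m1 * m2)%:R^-1 * \sum_(w : 'I_m1 * 'I_m2) label_prob Xs w (~~ eta w).

(* sign, with sign(0) = +1 *)
Definition sign_cls m1 m2 (X : 'M[R]_(m1, m2)) : classifier m1 m2 :=
  fun w => 0 <= X w.1 w.2.

Definition bayes m1 m2 (Xs : 'M[R]_(m1, m2)) : classifier m1 m2 := sign_cls Xs.

Definition excess m1 m2 n (Xs : 'M[R]_(m1, m2))
    (eta : sample m1 m2 n -> classifier m1 m2) : R :=
  \sum_(S : sample m1 m2 n) sample_prob Xs S * risk Xs (eta S) - risk Xs (bayes Xs).

Definition low_noise m1 m2 (Xs : 'M[R]_(m1, m2)) (c : R) : Prop :=
  unif_prob (fun w : 'I_m1 * 'I_m2 =>
     (0 < `|logistic (Xs w.1 w.2) - 2^-1|) && (`|logistic (Xs w.1 w.2) - 2^-1| < (2 * c)^-1))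
  = 0.

End Defs.

(* Main.v *)
(** Under the low-noise condition the excess risk is at most [4 c] times the mean
    squared distance between the success probabilities, which by comparison with
    the Hellinger distance is dominated by the excess population log-loss of the
    maximum likelihood estimator.

    The Kiefer-Wolfowitz theorem gives [max_norm X <= sqrt (rank X) * norm_inf X],
    so [X*] is feasible and the excess log-loss is bounded by the deviation of the
    empirical log-loss from its mean at the estimator.  Since the sample space is
    finite, the estimator has finitely many values and suprema are finite maxima.
    Symmetrization and the contraction principle (the logistic loss is
    1-Lipschitz) reduce the deviation to the Rademacher complexity of the max-norm
    ball; Grothendieck's inequality replaces that ball by the [2 ^ d] sign matrices
    of rank one, and Massart's finite class lemma gives the rate [sqrt (d / n)]. *)

Require Import Defs.
From HB Require Import structures.
From mathcomp Require Import all_boot all_order all_algebra perm.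
From mathcomp Require Import all_classical all_reals all_analysis.
From mathcomp Require Import ring lra.
Set Implicit Arguments.
Unset Strict Implicit.
Unset Printing Implicit Defensive.
Import Order.TTheory GRing.Theory Num.Theory.
Local Open Scope ring_scope.

(** * Near-optimal designs and the max-norm of a low-rank matrix *)

Section MaxNormBound.
Variable R : realType.

(** The matrix determinant lemma: eliminating either diagonal block of the same bordered matrix [B]
    gives two block-triangular factorizations, whose determinants must agree. *)
Lemma det_1_add_col_row n (v : 'cV[R]_n) (u : 'rV[R]_n) :
  \det (1%:M + v *m u) = 1 + (u *m v) 0 0.
Proof.
pose B := block_mx 1%:M (- u) v (1%:M : 'M[R]_n).
have EL : B = block_mx 1%:M 0 v 1%:M *m block_mx 1%:M (- u) 0 (1%:M + v *m u).
  rewrite mulmx_block !mul1mx !mul0mx !mulmx1 !addr0 mulmxN.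
  by rewrite addrCA addNr addr0.
have EU : B = block_mx 1%:M (- u) 0 1%:M *m block_mx (1%:M + u *m v) 0 v 1%:M.
  rewrite mulmx_block !mul1mx !mul0mx !mulmx1 !add0r mulNmx.
  by rewrite addrK.
have := EL; rewrite EU => /(congr1 determinant).
rewrite !det_mulmx !det_ublock !det_lblock !det1 !mul1r mulr1 => <-.
by rewrite det_mx11 !mxE.
Qed.

(** Controls the normalization [(1 + t) ^+ r] of a perturbed design to first order. Any [K] will do,
    since the step [t] is chosen after it. *)
Lemma exprD1_le_quadratic (r : nat) : exists2 K : R, 0 <= K &
  forall t, 0 <= t <= 1 -> (1 + t) ^+ r <= 1 + r%:R * t + K * t ^+ 2.
Proof.
elim: r => [|r [K K0 IH]].
  by exists 0 => // t _; rewrite expr0 !mul0r !addr0.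
exists (r%:R + 2 * K); first by rewrite addr_ge0 ?mulr_ge0.
move=> t /[dup] /IH H /andP[t0 t1]; rewrite exprSr -natr1.
apply: (@le_trans _ _ ((1 + r%:R * t + K * t ^+ 2) * (1 + t))).
  by rewrite ler_wpM2r // addr_ge0.
have : K * t ^+ 3 <= K * t ^+ 2.
  by rewrite ler_wpM2l // exprS ler_piMl // sqr_ge0.
nra.
Qed.

(** The information matrix of the design [p] on the rows of [A], as in D-optimal design. *)
Definition gram m r (A : 'M[R]_(m, r)) (p : 'rV[R]_m) : 'M[R]_r :=
  A^T *m diag_mx p *m A.

Lemma gramE m r (A : 'M[R]_(m, r)) p j k :
  gram A p j k = \sum_i p 0 i * (A i j * A i k).
Proof.
rewrite /gram mxE; apply: eq_bigr => i _.
by rewrite mul_mx_diag !mxE; ring.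
Qed.

Lemma gram_const_unit m r (A : 'M[R]_(m, r)) (a : R) :
  a != 0 -> row_full A -> gram A (const_mx a) \in unitmx.
Proof.
move=> a0 fA; rewrite -row_free_unit; apply: inj_row_free => v.
rewrite /gram diag_const_mx mul_mx_scalar -scalemxAl -scalemxAr.
move=> /eqP; rewrite scaler_eq0 (negbTE a0) /= => /eqP vAA.
have fAT : row_free A^T by rewrite /row_free mxrank_tr; exact: fA.
apply: (row_free_inj fAT); rewrite mul0mx.
have : (v *m (A^T *m A) *m v^T) 0 0 = 0 by rewrite vAA mul0mx mxE.
rewrite mulmxA -mulmxA -{2}(trmxK A) -trmx_mul mxE => H.
apply/rowP => j; rewrite [RHS]mxE; apply/eqP; rewrite -sqrf_eq0.
have /psumr_eq0P -> // : \sum_j ((v *m A^T) 0 j) ^+ 2 = 0.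
  by rewrite -[RHS]H; apply: eq_bigr => i _; rewrite [(_^T) _ _]mxE expr2.
by move=> i _; exact: sqr_ge0.
Qed.

Definition simplex m : set 'rV[R]_m :=
  [set p | (forall i, 0 <= p 0 i) /\ \sum_i p 0 i = 1].

(** Each factor in the Leibniz expansion is at most [b], as the weights are at most 1. Boundedness
    gives a supremum with near-maximisers, so that no compactness argument is required. *)
Lemma norm_det_gram_bounded m r (A : 'M[R]_(m, r)) :
  exists B : R, forall p, simplex p -> `|\det (gram A p)| <= B.
Proof.
pose b := \sum_i \sum_j \sum_k `|A i j * A i k|.
exists (\sum_(s : {perm 'I_r}) \prod_(i < r) b) => p [p0 p1].
rewrite /determinant; apply: (le_trans (ler_norm_sum _ _ _)); apply: ler_sum => s _.
rewrite normrM normrX normrN1 expr1n mul1r normr_prod.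
apply: ler_prod => j _; rewrite normr_ge0 gramE /=.
apply: (le_trans (ler_norm_sum _ _ _)); apply: ler_sum => i _.
have pi1 : p 0 i <= 1.
  by rewrite -p1 (bigD1 i) //= lerDl sumr_ge0.
rewrite normrM ger0_norm //; apply: (@le_trans _ _ `|A i j * A i (s j)|).
  by rewrite ler_piMl.
rewrite (bigD1 j) //= (bigD1 (s j)) //= -addrA lerDl addr_ge0 // ?sumr_ge0 //.
by move=> k _; rewrite sumr_ge0.
Qed.

(** Extra mass on index [i] is a rank-one update of the Gram matrix by row [i] of [A], so the matrix
    determinant lemma produces the leverage of that row. *)
Lemma gram_add_delta m r (A : 'M[R]_(m, r)) p (i : 'I_m) (t : R) :
  gram A p \in unitmx ->
  \det (gram A (p + t *: delta_mx 0 i)) =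
  \det (gram A p) * (1 + t * (A *m invmx (gram A p) *m A^T) i i).
Proof.
move=> uM; set M := gram A p.
have -> : gram A (p + t *: delta_mx 0 i) =
    M *m (1%:M + (t *: (invmx M *m (row i A)^T)) *m row i A).
  rewrite mulmxDr mulmx1 -!scalemxAl -scalemxAr -(mulmxA (invmx M)) mulKVmx //.
  apply/matrixP => j k; rewrite gramE [RHS]mxE [M j k]gramE.
  rewrite [X in _ = _ + X]mxE [(_ *m _) j k]mxE big_ord1 !mxE.
  under eq_bigr do rewrite !mxE mulrDl.
  rewrite big_split /=; congr (_ + _).
  rewrite (bigD1 i) //= big1 ?addr0 ?eqxx ?andbT /= => [|l li].
    by rewrite mulr1.
  by rewrite eq_sym in li; rewrite ?(eq_sym l) ?(negbTE li) ?andbF ?mulr0 ?mul0r.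
rewrite det_mulmx det_1_add_col_row -scalemxAr; congr (_ * (1 + _)).
rewrite mxE; congr (_ * _).
rewrite mulmxA -row_mul [LHS]mxE [RHS]mxE.
by apply: eq_bigr => l _; rewrite !mxE.
Qed.

(* Kiefer-Wolfowitz: moving mass towards row [i] changes the determinant by the
   factor [(1 + t g) / (1 + t)^r], where [g] is the leverage of row [i]; a
   near-maximiser of the determinant therefore has no leverage much above [r]. *)
Lemma near_optimal_design m r (A : 'M[R]_(m, r)) (e : R) :
  (0 < m)%N -> row_full A -> 0 < e ->
  exists p, [/\ simplex p, gram A p \in unitmx &
    forall i, (A *m invmx (gram A p) *m A^T) i i <= r%:R + e].
Proof.
move=> m0 fA e0; have [B HB] := norm_det_gram_bounded A.
pose E := [set x : R | exists2 p, simplex p & x = `|\det (gram A p)|]%classic.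
have mR : m%:R != 0 :> R by rewrite pnatr_eq0 -lt0n.
pose p0 : 'rV[R]_m := const_mx m%:R^-1.
have sp0 : simplex p0.
  split=> [i|]; first by rewrite mxE invr_ge0.
  under eq_bigr do rewrite mxE.
  by rewrite sumr_const card_ord -[LHS]mulr_natr mulVf.
have supE : has_sup E.
  split; first by exists `|\det (gram A p0)|, p0.
  by exists B => x [p sp ->]; exact: HB.
have s0 : 0 < sup E.
  apply: (@lt_le_trans _ _ `|\det (gram A p0)|).
    rewrite normr_gt0; have := gram_const_unit (invr_neq0 mR) fA.
    by rewrite unitmxE unitfE.
  by apply: (sup_upper_bound supE); exists p0.
have [K K0 HK] := exprD1_le_quadratic r.
(* Small enough for [t <= 1] and [K * t <= e / 2], so that [(1 + t) ^+ r] stays below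
   [1 + t * (r%:R + e / 2)]. *)
pose t := e / (2 * K + e + 1).
have D0 : 0 < 2 * K + e + 1 by lra.
have t0 : 0 < t by rewrite divr_gt0.
have t1 : t <= 1 by rewrite ler_pdivrMr // mul1r; lra.
have Kt : K * t <= e / 2.
  by rewrite /t mulrA ler_pdivrMr //; nra.
have Ht : (1 + t) ^+ r <= 1 + t * (r%:R + e / 2).
  apply: (le_trans (HK t _)); first by rewrite ltW.
  have : K * t * t <= e / 2 * t by rewrite ler_pM2r.
  nra.
have r0 : 0 <= r%:R :> R by [].
have F0 : 0 < 1 + t * (r%:R + e / 2) by nra.
(* The required degree of near-maximality: if a design reaches more than the fraction [q] of the
   supremum, a leverage above [r%:R + e] would let [p'] exceed the supremum. *)
pose q := (1 + t * (r%:R + e / 2)) / (1 + t * (r%:R + e)).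
have G0 : 0 < 1 + t * (r%:R + e) by nra.
have q0 : 0 < q by rewrite divr_gt0.
have q1 : q < 1 by rewrite ltr_pdivrMr // mul1r; nra.
have [x [p sp xE] xq] : exists2 x, E x & q * sup E < x.
  have [//|x Ex H] := @sup_adherent _ E ((1 - q) * sup E) _ supE.
    by rewrite mulr_gt0 // subr_gt0.
  by exists x => //; apply: le_lt_trans H; rewrite mulrBl mul1r subKr.
have d0 : 0 < `|\det (gram A p)|.
  by rewrite -xE; apply: lt_trans xq; rewrite mulr_gt0.
have uM : gram A p \in unitmx by rewrite unitmxE unitfE -normr_gt0.
exists p; split => // i; set g := _ i i.
have tp : 0 < 1 + t by rewrite addr_gt0.
pose p' : 'rV[R]_m := (1 + t)^-1 *: (p + t *: delta_mx 0 i).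
have sp' : simplex p'.
  case: sp => pp ps; split=> [k|].
    by rewrite !mxE mulr_ge0 ?invr_ge0 ?(ltW tp) // addr_ge0 // mulr_ge0 // ltW.
  under eq_bigr do rewrite !mxE.
  rewrite -mulr_sumr big_split /= ps -mulr_sumr (bigD1 i) //= big1 => [|k ki].
    by rewrite !eqxx addr0 mulr1 mulVf // gt_eqF.
  by rewrite (negbTE ki).
have Ep' : `|\det (gram A p')| = (1 + t) ^- r * (`|\det (gram A p)| * `|1 + t * g|).
  have -> : gram A p' = (1 + t)^-1 *: gram A (p + t *: delta_mx 0 i).
    apply/matrixP => j k; rewrite [RHS]mxE !gramE mulr_sumr.
    by apply: eq_bigr => l _; rewrite [p' 0 l]mxE -mulrA.
  by rewrite detZ gram_add_delta // !normrM exprVn ger0_norm // invr_ge0 exprn_ge0 // ltW.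
have : `|\det (gram A p')| <= sup E by apply: (sup_upper_bound supE); exists p'.
rewrite Ep' mulrC ler_pdivrMr ?exprn_gt0 // -xE => H1.
have H2 : x * (1 + t * g) <= sup E * (1 + t * (r%:R + e / 2)).
  apply: (@le_trans _ _ (x * `|1 + t * g|)).
    by rewrite ler_wpM2l ?ler_norm // xE.
  by apply: (le_trans H1); rewrite ler_wpM2l // ltW.
rewrite leNgt; apply/negP => gt.
have : sup E * (1 + t * (r%:R + e / 2)) < x * (1 + t * (r%:R + e)).
  by rewrite -ltr_pdivrMr // -mulrA mulrC.
have : x * (1 + t * (r%:R + e)) <= x * (1 + t * g).
  rewrite ler_wpM2l ?xE // lerD2l ler_wpM2l //; exact: ltW.
by move=> a b; have := lt_le_trans b (le_trans a H2); rewrite ltxx.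
Qed.

Lemma entry_le_norm_inf m1 m2 (X : 'M[R]_(m1, m2)) i j : `|X i j| <= norm_inf X.
Proof.
rewrite /norm_inf; apply: (@le_trans _ _ (\big[Num.max/0]_(j < m2) `|X i j|)).
  exact: le_bigmax.
exact: (le_bigmax _ (fun i => \big[Num.max/0]_(j < m2) `|X i j|)).
Qed.

Lemma norm_2inf_ge0 m k (U : 'M[R]_(m, k)) : 0 <= norm_2inf U.
Proof. by rewrite /norm_2inf; apply: bigmax_ge_id. Qed.

Lemma row_le_norm_2inf m k (U : 'M[R]_(m, k)) i :
  \sum_j U i j ^+ 2 <= norm_2inf U ^+ 2.
Proof.
rewrite -[leLHS]sqr_sqrtr ?sumr_ge0 // => [|j _]; last exact: sqr_ge0.
rewrite ler_pXn2r // ?nnegrE ?sqrtr_ge0 ?norm_2inf_ge0 //.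
exact: (le_bigmax _ (fun i => Num.sqrt (\sum_j U i j ^+ 2))).
Qed.

Lemma norm_2inf_le m k (U : 'M[R]_(m, k)) (a : R) : 0 <= a ->
  (forall i, \sum_j U i j ^+ 2 <= a ^+ 2) -> norm_2inf U <= a.
Proof.
move=> a0 H; apply/bigmax_leP; split=> // i _.
by rewrite -[leRHS](ger0_norm a0) -sqrtr_sqr ler_wsqrtr.
Qed.

Lemma max_norm_le_factor m1 m2 k (U : 'M[R]_(m1, k)) (V : 'M[R]_(m2, k)) :
  max_norm (U *m V^T) <= norm_2inf U * norm_2inf V.
Proof.
apply: ge_inf; last by exists k, U, V.
exists 0 => x [l [U' [V' [_ ->]]]].
by rewrite mulr_ge0 ?norm_2inf_ge0.
Qed.

(** With [D] the diagonal matrix of the square roots of a near-optimal design, [X] factors through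
    [U] and [V] below. The squared row norms of [U] are leverages, about the rank; those of [V] are
    weighted averages of squared entries of [X], at most [gamma ^+ 2]. *)
Lemma max_norm_le_rank m1 m2 (X : 'M[R]_(m1, m2)) (gamma : R) :
  (0 < m1)%N -> 0 < gamma -> norm_inf X <= gamma ->
  max_norm X <= gamma * Num.sqrt (\rank X)%:R.
Proof.
(* The slack [f] in the leverage is a square, so that the norm of a row of [U] exceeds the root of
   the rank by at most [e / gamma], and the product of norms by at most [e]. *)
move=> m0 g0 Xg; apply/ler_addgt0Pr => e e0.
pose f := (e / gamma) ^+ 2; have eg0 : 0 < e / gamma by rewrite divr_gt0.
have f0 : 0 < f by rewrite exprn_gt0.
have [A fA [B XAB]] : exists2 A : 'M[R]_(m1, \rank X), row_full A & exists B, X = A *m B.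
  exists (col_base X); first exact: col_base_full.
  by exists (row_base X); rewrite mulmx_base.
have [p [[p0 p1] uM lev]] := near_optimal_design m0 fA f0.
pose D : 'M[R]_m1 := diag_mx (\row_i Num.sqrt (p 0 i)).
have DD : D *m D = diag_mx p.
  rewrite mulmx_diag; congr diag_mx; apply/rowP => i.
  by rewrite !mxE -expr2 sqr_sqrtr.
have DT : D^T = D by rewrite tr_diag_mx.
set M := gram A p in uM lev.
have MT : M^T = M.
  by apply/matrixP => j k; rewrite mxE !gramE; apply: eq_bigr => i _; rewrite (mulrC (A i k)).
pose U := A *m invmx M *m A^T *m D.
pose V := X^T *m D.
have UV : X = U *m V^T.
  rewrite trmx_mul DT trmxK /U -!mulmxA (mulmxA D D) DD.
  have -> : diag_mx p *m X = diag_mx p *m A *m B by rewrite -mulmxA -XAB.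
  rewrite (mulmxA A^T) (mulmxA A^T) -/(gram A p) -/M.
  by rewrite mulKmx.
have UU : U *m U^T = A *m invmx M *m A^T.
  rewrite /U !trmx_mul trmxK DT trmx_inv MT !mulmxA.
  rewrite -(mulmxA _ D D) DD -!mulmxA (mulmxA (diag_mx p)) (mulmxA A^T) (mulmxA A^T).
  by rewrite -/(gram A p) -/M mulKmx.
rewrite UV; apply: (le_trans (max_norm_le_factor _ _)).
apply: (@le_trans _ _ ((Num.sqrt (\rank X)%:R + e / gamma) * gamma)); last first.
  by rewrite -UV mulrDl divfK ?gt_eqF // mulrC.
apply: ler_pM; rewrite ?norm_2inf_ge0 //; apply: norm_2inf_le.
- by rewrite addr_ge0 ?sqrtr_ge0 // ltW.
- move=> i; apply: (@le_trans _ _ ((\rank X)%:R + f)).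
    apply: le_trans (lev i); rewrite -UU mxE.
    by apply: ler_sum => j _; rewrite [U^T _ _]mxE expr2.
  rewrite sqrrD sqr_sqrtr // -/f -addrA lerD2l lerDr mulrn_wge0 //.
  by rewrite mulr_ge0 ?sqrtr_ge0 // ltW.
- exact: ltW.
- move=> j; rewrite -[leRHS]mul1r -p1 mulr_suml; apply: ler_sum => i _.
  rewrite /V mul_mx_diag !mxE exprMn sqr_sqrtr // mulrC ler_wpM2l //.
  rewrite -[X i j ^+ 2]real_normK ?num_real // ler_pXn2r // ?nnegrE ?(ltW g0) //.
  exact: le_trans (entry_le_norm_inf _ _ _) Xg.
Qed.

End MaxNormBound.

(** * Grothendieck's inequality, with constant 8 *)

Section Grothendieck.
Variable R : realType.

Definition fmax (T : finType) (t0 : T) (F : T -> R) : R :=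
  F [arg max_(t > t0) F t]%O.

Lemma fmax_ge (T : finType) (t0 : T) (F : T -> R) t : F t <= fmax t0 F.
Proof. by rewrite /fmax; case: arg_maxP => // i _ H; exact: H. Qed.

Lemma fmax_le (T : finType) (t0 : T) (F : T -> R) a :
  (forall t, F t <= a) -> fmax t0 F <= a.
Proof. by move=> H; exact: H. Qed.

(** The columns of [Xi] play the outcomes of a Rademacher vector under the uniform law. The two
    conditions are the isotropy of the second moments and the Khintchine bound with constant 3 on
    the fourth. *)
Lemma rademacher_matrix k : exists N (Xi : 'M[R]_(k, N)),
  [/\ (0 < N)%N, Xi *m Xi^T = N%:R%:M &
    forall u : 'rV_k, \sum_t (u *m Xi) 0 t ^+ 4 <=
      3 * N%:R * (\sum_j u 0 j ^+ 2) ^+ 2].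
Proof.
elim: k => [|k [N [Xi [N0 XX X4]]]].
  exists 1%N, 0; split=> //; first by apply/matrixP => - [].
  by move=> u; rewrite !big_ord0 expr0n mulr0 big_ord1 mulmx0 mxE expr0n.
(* One more independent sign doubles the outcomes: two copies of [Xi], with new coordinate 1 on the
   first and -1 on the second. *)
pose Z : 'M[R]_(1 + k, N + N) := block_mx (const_mx 1) (const_mx (-1)) Xi Xi.
exists (N + N)%N, Z; split; first by rewrite addn_gt0 N0.
  suff : @mulmx _ (1 + k) _ (1 + k) Z Z^T = (N + N)%:R%:M by [].
  rewrite /Z tr_block_mx mulmx_block XX natrD.
  rewrite (scalar_mx_block 1 k) !raddfD /=; congr block_mx.
  - apply/matrixP => i j; rewrite !ord1 !mxE /=.
    under eq_bigr do rewrite !mxE mulr1.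
    under [X in _ + X]eq_bigr do rewrite !mxE mulrNN mulr1.
    by rewrite !sumr_const !card_ord.
  - rewrite -mulmxDl; apply/matrixP => i j; rewrite !mxE big1 // => l _.
    by rewrite !mxE subrr mul0r.
  - rewrite -mulmxDr; apply/matrixP => i j; rewrite !mxE big1 // => l _.
    by rewrite !mxE subrr mulr0.
suff H (u : 'rV[R]_(1 + k)) : \sum_t (u *m Z) 0 t ^+ 4 <=
    3 * (N + N)%:R * (\sum_j u 0 j ^+ 2) ^+ 2 by exact: H.
rewrite -[u]hsubmxK.
set b := lsubmx _; set w := rsubmx _; pose a := b 0 0; pose x := w *m Xi.
set s := \sum_j w 0 j ^+ 2.
have s0 : 0 <= s by rewrite sumr_ge0 // => j _; rewrite sqr_ge0.
have x2 : \sum_t x 0 t ^+ 2 = N%:R * s.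
  have : (x *m x^T) 0 0 = (N%:R *: (w *m w^T)) 0 0.
    by rewrite /x trmx_mul mulmxA -(mulmxA w) XX mul_mx_scalar -scalemxAl.
  rewrite [LHS]mxE [RHS]mxE [(w *m w^T) 0 0]mxE.
  under eq_bigr do rewrite [(_^T) _ _]mxE -expr2.
  by under [in RHS]eq_bigr do rewrite [(_^T) _ _]mxE -expr2.
rewrite (@big_split_ord _ _ _ 1 k) /= big_ord1 row_mxEl -/a.
under [X in (_ + X) ^+ 2]eq_bigr do rewrite row_mxEr.
rewrite -/s (@big_split_ord _ _ _ N N) /= /Z mul_row_block.
under eq_bigr do rewrite row_mxEl.
under [X in _ + X <= _]eq_bigr do rewrite row_mxEr.
rewrite -big_split /=.
(* Pairing the two copies cancels the odd powers of the new coordinate. *)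
have -> : \sum_(i < N) ((b *m const_mx 1 + w *m Xi) 0 i ^+ 4 +
   (b *m const_mx (-1) + w *m Xi) 0 i ^+ 4) =
   2 * \sum_t x 0 t ^+ 4 + 12 * a ^+ 2 * \sum_t x 0 t ^+ 2 + 2 * a ^+ 4 * N%:R.
  have -> : 2 * a ^+ 4 * N%:R = \sum_(t < N) 2 * a ^+ 4.
    by rewrite sumr_const card_ord mulr_natr.
  rewrite !mulr_sumr -!big_split /=.
  apply: eq_bigr => t _; rewrite mxE [X in _ + X ^+ 4]mxE -/x.
  have bm (c : R) : (b *m const_mx c : 'rV[R]_N) 0 t = a * c.
    by rewrite mxE big_ord1 [const_mx _ _ _]mxE.
  by rewrite !bm; ring.
rewrite x2; have := X4 w; rewrite -/s -/x natrD => H.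
have N0' : 0 <= N%:R :> R by [].
have : 0 <= N%:R * a ^+ 4 by rewrite mulr_ge0 // -[4%N]/(2 * 2)%N exprM sqr_ge0.
nra.
Qed.

Definition clip (x : R) : R := Num.max (-2) (Num.min 2 x).

(** The tail bound is [y - 2 <= y ^+ 2 / 8] for [y = |x|], that is [(y - 4) ^+ 2 >= 0], squared. *)
Lemma clip_spec x :
  [/\ `|clip x| <= 2, clip x ^+ 2 <= x ^+ 2 & (x - clip x) ^+ 2 <= x ^+ 4 / 64].
Proof.
have K (y : R) : 2 <= y -> (y - 2) ^+ 2 <= y ^+ 4 / 64.
  move=> y2; have -> : y ^+ 4 / 64 = (y ^+ 2 / 8) ^+ 2 by field.
  have := sqr_ge0 (y - 4) => ?.
  by apply: lerXn2r; rewrite ?nnegrE ?divr_ge0 ?sqr_ge0 //; nra.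
rewrite /clip; case: (leP 2 x) => x2; last case: (leP (-2) x) => x3.
- have -> : Num.max (-2) 2 = 2 :> R by apply/max_idPr; lra.
  by split; [rewrite ger0_norm | nra | exact: K].
- split; first by rewrite ler_norml; lra.
    by [].
  by rewrite subrr expr0n divr_ge0 // -[4%N]/(2 * 2)%N exprM sqr_ge0.
- split; first by rewrite ler0_norm; lra.
    by nra.
  have := K (- x); rewrite -[(- x - 2) ^+ 2]sqrrN opprD !opprK => H.
  by have := H _; rewrite -[4%N]/(2 * 2)%N !exprM sqrrN; apply; lra.
Qed.

Section Fixed_matrix.
Variables (m1 m2 : nat) (G : 'M[R]_(m1, m2)).

Definition mxdot (X : 'M[R]_(m1, m2)) : R := \sum_i \sum_j G i j * X i j.

Lemma mxdotD X Y : mxdot (X + Y) = mxdot X + mxdot Y.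
Proof.
rewrite -big_split; apply: eq_bigr => i _; rewrite -big_split /=.
by apply: eq_bigr => j _; rewrite mxE mulrDr.
Qed.

Lemma mxdotZ a X : mxdot (a *: X) = a * mxdot X.
Proof.
rewrite mulr_sumr; apply: eq_bigr => i _; rewrite mulr_sumr.
by apply: eq_bigr => j _; rewrite mxE mulrCA.
Qed.

(* The norm of [G] as an operator from l^infinity to l^1. *)
Definition sign_norm : R :=
  fmax ([ffun=> false], [ffun=> false])
    (fun s : {ffun 'I_m1 -> bool} * {ffun 'I_m2 -> bool} =>
      \sum_i \sum_j G i j * ((-1) ^+ s.1 i * (-1) ^+ s.2 j)).

Lemma sum_le_sign (I : finType) (c x : I -> R) : (forall i, `|x i| <= 1) ->
  \sum_i c i * x i <= \sum_i c i * (-1) ^+ (c i < 0)%R.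
Proof.
move=> x1; apply: ler_sum => i _; rewrite -[leRHS]mulrC -normrEsign.
apply: (le_trans (ler_norm _)); rewrite normrM -[leRHS]mulr1.
by rewrite ler_wpM2l.
Qed.

(** The form is linear in each argument: with [y] fixed the best [x] is a sign vector, and with
    those signs fixed so is the best [y]. *)
Lemma le_sign_norm (x : 'I_m1 -> R) (y : 'I_m2 -> R) :
  (forall i, `|x i| <= 1) -> (forall j, `|y j| <= 1) ->
  \sum_i \sum_j G i j * (x i * y j) <= sign_norm.
Proof.
move=> x1 y1; pose c i := \sum_j G i j * y j.
pose s := [ffun i => c i < 0]; pose d j := \sum_i G i j * (-1) ^+ s i.
pose t := [ffun j => d j < 0].
apply: (@le_trans _ _ (\sum_i c i * x i)).
  apply: ler_sum => i _; rewrite mulr_suml; apply: ler_sum => j _.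
  by rewrite -mulrA (mulrC (x i)).
apply: (le_trans (sum_le_sign c x1)).
apply: (@le_trans _ _ (\sum_j d j * y j)).
  under eq_bigr do rewrite mulr_suml.
  rewrite exchange_big /=; apply: ler_sum => j _; rewrite mulr_suml.
  by apply: ler_sum => i _; rewrite /s ffunE mulrAC.
apply: (le_trans (sum_le_sign d y1)).
apply: le_trans (fmax_ge _ _ (s, t)) => /=.
under eq_bigr do rewrite mulr_suml.
rewrite exchange_big /=; apply: ler_sum => i _; apply: ler_sum => j _.
by rewrite [t j]ffunE mulrA.
Qed.

Lemma sign_norm_ge0 : 0 <= sign_norm.
Proof.
apply: le_trans (@le_sign_norm (fun=> 0) (fun=> 0) _ _); last 2 first.
- by move=> i; rewrite normr0.
- by move=> i; rewrite normr0.
by apply: sumr_ge0 => i _; apply: sumr_ge0 => j _; rewrite !mulr0.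
Qed.

Definition rows_le m k (a : R) (U : 'M[R]_(m, k)) :=
  forall i, \sum_j U i j ^+ 2 <= a ^+ 2.

(** The supremum of this set, over all dimensions [k], is the dual of the max-norm evaluated at [G];
    Grothendieck's inequality compares it with [sign_norm]. *)
Definition gram_values := [set v : R | exists k (U : 'M[R]_(m1, k)) (V : 'M[R]_(m2, k)),
  [/\ rows_le 1 U, rows_le 1 V & v = mxdot (U *m V^T)]]%classic.

Lemma has_sup_gram_values : has_sup gram_values.
Proof.
split.
  exists (mxdot ((0 : 'M[R]_(m1, 0)) *m (0 : 'M[R]_(m2, 0))^T)), 0%N, 0, 0.
  by split=> // i; rewrite big_ord0 expr1n.
exists (\sum_i \sum_j `|G i j|) => v [k [U [V [U1 V1 ->]]]].
apply: ler_sum => i _; apply: ler_sum => j _.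
apply: (le_trans (ler_norm _)); rewrite normrM -[leRHS]mulr1 ler_wpM2l //.
have := U1 i; have := V1 j; rewrite expr1n => Vj Ui.
apply: (@le_trans _ _ (\sum_l (U i l ^+ 2 + V j l ^+ 2) / 2)).
  rewrite mxE; apply: (le_trans (ler_norm_sum _ _ _)); apply: ler_sum => l _.
  rewrite mxE ler_norml; have := sqr_ge0 (U i l + V j l).
  have := sqr_ge0 (U i l - V j l); rewrite !expr2 => ? ?.
  by apply/andP; split; nra.
by rewrite -mulr_suml big_split /=; lra.
Qed.

(** Homogeneity in both factors. A zero radius cannot be rescaled, but it forces the factor to
    vanish. *)
Lemma mxdot_le_sup k (U : 'M[R]_(m1, k)) (V : 'M[R]_(m2, k)) a b :
  0 <= a -> 0 <= b -> rows_le a U -> rows_le b V ->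
  mxdot (U *m V^T) <= a * b * sup gram_values.
Proof.
have rows0 m (W : 'M[R]_(m, k)) : rows_le 0 W -> W = 0.
  move=> W0; apply/matrixP => i j; rewrite mxE; apply/eqP; rewrite -sqrf_eq0.
  have Wi : \sum_j W i j ^+ 2 = 0.
    apply/eqP; rewrite eq_le sumr_ge0 ?andbT; last by move=> l _; rewrite sqr_ge0.
    by have := W0 i; rewrite expr0n.
  by rewrite (psumr_eq0P _ Wi) // => l _; rewrite sqr_ge0.
have dot0 : mxdot 0 = 0 by rewrite -(scale0r 0) mxdotZ mul0r.
rewrite le_eqVlt => /predU1P[<- _ /rows0 -> _|a0].
  by rewrite mul0mx dot0 !mul0r.
rewrite le_eqVlt => /predU1P[<- _ /rows0 ->|b0 Ua Vb].
  by rewrite trmx0 mulmx0 dot0 mulr0 mul0r.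
have scal m (W : 'M[R]_(m, k)) e : 0 < e -> rows_le e W -> rows_le 1 (e^-1 *: W).
  move=> e0 We i; under eq_bigr do rewrite mxE exprMn.
  rewrite -mulr_sumr exprVn mulrC ler_pdivrMr ?exprn_gt0 // expr1n mul1r.
  exact: We.
rewrite -ler_pdivrMl ?mulr_gt0 //; apply: (sup_upper_bound has_sup_gram_values).
exists k, (a^-1 *: U), (b^-1 *: V); split; [exact: scal|exact: scal|].
by rewrite linearZ /= -scalemxAr -scalemxAl scalerA mxdotZ invfM (mulrC b^-1).
Qed.

(* Representing [<u_i, v_j>] as [E (u_i . xi) (v_j . xi)] with Rademacher [xi]
   and truncating both variables at level 2: the truncated parts are bounded by
   the sign norm, and the tails have L^2 norm at most 1/4, so they contribute at
   most half of the supremum itself. *)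
Lemma sup_gram_values_le : sup gram_values <= 8 * sign_norm.
Proof.
set Gam := sup gram_values.
(* The supremum is finite, so the half of it on the right can be absorbed. *)
suff H : Gam <= 4 * sign_norm + Gam / 2 by lra.
apply: ge_sup; first by case: has_sup_gram_values.
move=> _ [k [U [V [U1 V1 ->]]]].
have [N [Xi [N0 XX X4]]] := rademacher_matrix k.
pose sN : R := Num.sqrt N%:R.
have NR : 0 < N%:R :> R by rewrite ltr0n.
have sN0 : 0 <= sN by rewrite sqrtr_ge0.
have sN2 : sN ^+ 2 = N%:R by rewrite sqr_sqrtr.
have mul2 m (W : 'M[R]_(m, k)) : rows_le 1 W -> rows_le sN (W *m Xi).
  move=> W1 i; rewrite sN2.
  have -> : \sum_j (W *m Xi) i j ^+ 2 = N%:R * \sum_j W i j ^+ 2.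
    have : ((W *m Xi) *m (W *m Xi)^T) i i = (N%:R *: (W *m W^T)) i i.
      by rewrite trmx_mul mulmxA -(mulmxA W) XX mul_mx_scalar -scalemxAl.
    rewrite [LHS]mxE [RHS]mxE [(W *m W^T) i i]mxE.
    under eq_bigr do rewrite [(_^T) _ _]mxE -expr2.
    by under [in RHS]eq_bigr do rewrite [(_^T) _ _]mxE -expr2.
  by rewrite -[leRHS]mulr1 ler_pM2l //; have := W1 i; rewrite expr1n.
(* The fourth moment gives a squared tail norm of at most [3 * N / 64], below [N / 16]. *)
have tail m (W : 'M[R]_(m, k)) : rows_le 1 W ->
    rows_le (sN / 4) (W *m Xi - map_mx clip (W *m Xi)).
  move=> W1 i; have := W1 i; set s := \sum_j _; rewrite expr1n => s1.
  have s0 : 0 <= s by rewrite sumr_ge0 // => j _; rewrite sqr_ge0.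
  apply: (@le_trans _ _ (\sum_j (W *m Xi) i j ^+ 4 / 64)).
    apply: ler_sum => j _; rewrite !mxE -/(W *m Xi).
    by case: (clip_spec (\sum_j0 W i j0 * Xi j0 j)).
  rewrite -mulr_suml; have := X4 (row i W).
  under eq_bigr do rewrite -row_mul mxE.
  under [X in _ <= _ * X ^+ 2]eq_bigr do rewrite mxE.
  rewrite -/s => H; rewrite expr_div_n sN2.
  have : s ^+ 2 <= 1 by rewrite expr_le1.
  by nra.
have clip2 m (W : 'M[R]_(m, k)) : rows_le sN (W *m Xi) ->
    rows_le sN (map_mx clip (W *m Xi)).
  move=> H i; apply: le_trans (H i); apply: ler_sum => j _.
  by rewrite [map_mx _ _ _ _]mxE; case: (clip_spec ((W *m Xi) i j)).
pose X := U *m Xi; pose Y := V *m Xi.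
pose T := map_mx clip X; pose S := map_mx clip Y.
have XY : N%:R *: (U *m V^T) = T *m S^T + (X - T) *m Y^T + T *m (Y - S)^T.
  rewrite mulmxBl [(Y - S)^T]linearB /= mulmxBr addrA -(addrA (T *m _)) subrK.
  rewrite (addrC (T *m _)) addrK.
  by rewrite /X /Y trmx_mul mulmxA -(mulmxA U) XX mul_mx_scalar -scalemxAl.
have TS : mxdot (T *m S^T) <= N%:R * (4 * sign_norm).
  have -> : mxdot (T *m S^T) =
      \sum_t 4 * \sum_i \sum_j G i j * (T i t / 2 * (S j t / 2)).
    transitivity (\sum_t \sum_i \sum_j G i j * (T i t * S j t)).
      rewrite exchange_big; apply: eq_bigr => i _ /=; rewrite exchange_big.
      apply: eq_bigr => j _ /=; rewrite mxE mulr_sumr.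
      by apply: eq_bigr => t _; rewrite [S^T _ _]mxE.
    apply: eq_bigr => t _; rewrite mulr_sumr; apply: eq_bigr => i _.
    by rewrite mulr_sumr; apply: eq_bigr => j _; field.
  have -> : N%:R * (4 * sign_norm) = \sum_(t < N) 4 * sign_norm.
    by rewrite sumr_const card_ord mulr_natl.
  apply: ler_sum => t _.
  rewrite ler_pM2l //; apply: le_sign_norm => i.
    rewrite mxE normrM (gtr0_norm (x := 2^-1)) // ler_pdivrMr // mul1r.
    by case: (clip_spec (X i t)).
  rewrite mxE normrM (gtr0_norm (x := 2^-1)) // ler_pdivrMr // mul1r.
  by case: (clip_spec (Y i t)).
have s40 : 0 <= sN / 4 by rewrite divr_ge0.
have H1 := mxdot_le_sup s40 sN0 (tail _ U U1) (mul2 _ V V1).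
have H2 := mxdot_le_sup sN0 s40 (clip2 _ U (mul2 _ U U1)) (tail _ V V1).
rewrite -(ler_pM2l NR) -mxdotZ XY !mxdotD.
move: TS H1 H2; rewrite -/X -/Y -/T -/S -/Gam.
have -> : sN / 4 * sN * Gam = N%:R * (Gam / 4) by rewrite -sN2; field.
have -> : sN * (sN / 4) * Gam = N%:R * (Gam / 4) by rewrite -sN2; field.
by lra.
Qed.

(** The max-norm is an infimum, so a factorization within [e] of it is used and then [e] tends to
    0. *)
Lemma mxdot_le_max_norm X (B : R) : max_norm X <= B ->
  mxdot X <= 8 * B * sign_norm.
Proof.
move=> XB; have s0 := sign_norm_ge0.
pose E := [set t : R | exists (k : nat) (U : 'M[R]_(m1, k)) (V : 'M[R]_(m2, k)),
        X = U *m V^T /\ t = norm_2inf U * norm_2inf V]%classic.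
have infE : has_inf E.
  split; first by exists (norm_2inf X * norm_2inf (1%:M : 'M[R]_m2)), m2, X, 1%:M;
    rewrite trmx1 mulmx1.
  exists 0 => x [l [U' [V' [_ ->]]]].
  by rewrite mulr_ge0 ?norm_2inf_ge0.
have H e : 0 < e -> mxdot X <= 8 * (B + e) * sign_norm.
  move=> e0; have [_ [k [U [V [XUV ->]]]] lt] := inf_adherent e0 infE.
  have := mxdot_le_sup (norm_2inf_ge0 U) (norm_2inf_ge0 V)
    (row_le_norm_2inf U) (row_le_norm_2inf V).
  rewrite -XUV => /le_trans; apply.
  apply: (@le_trans _ _ (norm_2inf U * norm_2inf V * (8 * sign_norm))).
    by rewrite ler_wpM2l ?mulr_ge0 ?norm_2inf_ge0 // sup_gram_values_le.
  rewrite mulrCA -mulrA ler_pM2l // ler_wpM2r //.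
  by apply: (le_trans (ltW lt)); rewrite lerD2r.
apply/ler_addgt0Pr => e e0.
have D0 : 0 < 8 * sign_norm + 1 by lra.
apply: (le_trans (H (e / (8 * sign_norm + 1)) _)); first by rewrite divr_gt0.
rewrite mulrDr mulrDl lerD2l mulrAC mulrA ler_pdivrMr //.
by nra.
Qed.

End Fixed_matrix.
End Grothendieck.

(** * Symmetrization, contraction and Massart's lemma over finite classes *)

Section EmpiricalProcess.
Variable R : realType.

Lemma sum_ffun_prod (Z : finType) (n : nat) (p : Z -> R) : \sum_z p z = 1 ->
  \sum_(S : {ffun 'I_n -> Z}) \prod_i p (S i) = 1.
Proof.
move=> p1; rewrite -(bigA_distr_bigA (fun (i : 'I_n) z => p z)) /=.
by rewrite big1.
Qed.

Lemma sum_ffun_marginal (Z : finType) (n : nat) (p g : Z -> R) (i : 'I_n) :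
  \sum_z p z = 1 ->
  \sum_(S : {ffun 'I_n -> Z}) (\prod_j p (S j)) * g (S i) = \sum_z p z * g z.
Proof.
move=> p1; transitivity (\sum_(S : {ffun 'I_n -> Z})
    \prod_j (p (S j) * (if j == i then g (S j) else 1))).
  apply: eq_bigr => S _; rewrite big_split /=; congr (_ * _).
  by rewrite -big_mkcond big_pred1_eq.
rewrite -(bigA_distr_bigA (fun (j : 'I_n) z => p z * (if j == i then g z else 1))) /=.
rewrite (bigD1 i) //= eqxx [X in _ * X]big1 ?mulr1 // => j /negbTE ->.
by under eq_bigr do rewrite mulr1.
Qed.

Section Rademacher.
Variables (T : finType) (t0 : T) (n : nat).
Local Notation signs := {ffun 'I_n -> bool}.

(* [2 ^ n] times the Rademacher average of the family [x]. *)
Definition rademacher_sum (x : T -> 'I_n -> R) : R :=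
  \sum_(eps : signs) fmax t0 (fun t => \sum_i (-1) ^+ eps i * x t i).

Lemma card_signs : #|{: signs}| = (2 ^ n)%N.
Proof. by rewrite card_ffun card_bool card_ord. Qed.

(** The data-dependent choice [tau S] is dominated by a maximum over [T]. A ghost sample replaces
    the mean; exchanging coordinates of the two samples introduces the signs, and each sample then
    contributes one Rademacher sum. *)
Lemma symmetrization (Z : finType) (p : Z -> R) (phi : T -> Z -> R)
    (tau : {ffun 'I_n -> Z} -> T) :
  (forall z, 0 <= p z) -> \sum_z p z = 1 ->
  2 ^+ n * \sum_(S : {ffun 'I_n -> Z}) (\prod_i p (S i)) *
      \sum_i (\sum_z p z * phi (tau S) z - phi (tau S) (S i)) <=
  2 * \sum_(S : {ffun 'I_n -> Z}) (\prod_i p (S i)) *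
      rademacher_sum (fun t i => phi t (S i)).
Proof.
move=> p0 p1; pose P (S : {ffun 'I_n -> Z}) := \prod_i p (S i).
have P0 S : 0 <= P S by apply: prodr_ge0.
pose M (e : signs) (w : {ffun 'I_n -> Z} * {ffun 'I_n -> Z}) :=
  fmax t0 (fun t => \sum_i (-1) ^+ e i * (phi t (w.2 i) - phi t (w.1 i))).
pose e0 : signs := [ffun=> false].
(* Swapping the coordinates where [e] is true preserves the product law and flips exactly the
   corresponding signs. *)
have swapM e : \sum_w P w.1 * P w.2 * M e w = \sum_w P w.1 * P w.2 * M e0 w.
  pose sw (w : {ffun 'I_n -> Z} * {ffun 'I_n -> Z}) :
      {ffun 'I_n -> Z} * {ffun 'I_n -> Z} :=
    ([ffun i => if e i then w.2 i else w.1 i],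
     [ffun i => if e i then w.1 i else w.2 i]).
  have swK : involutive sw.
    case=> S S'; congr (_, _); apply/ffunP => i; rewrite !ffunE /=;
    by case: (e i) => //=.
  rewrite (reindex_inj (inv_inj swK)) /=; apply: eq_bigr => w _; congr (_ * _).
    rewrite /P -!big_split /=; apply: eq_bigr => i _; rewrite !ffunE.
    by case: (e i) => //; rewrite mulrC.
  rewrite /M; congr (fmax t0 _); apply: funext => t; apply: eq_bigr => i _.
  rewrite !ffunE expr0 mul1r; case: (e i) => /=; last by rewrite expr0 mul1r.
  by rewrite expr1 mulN1r opprB.
pose A (e : signs) (S : {ffun 'I_n -> Z}) :=
  fmax t0 (fun t => \sum_i (-1) ^+ e i * phi t (S i)).
pose ng (e : signs) : signs := [ffun i => ~~ e i].
have ngK : involutive ng by move=> e; apply/ffunP => i; rewrite !ffunE negbK.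
have MA e w : M e w <= A e w.2 + A (ng e) w.1.
  apply: fmax_le => t; under eq_bigr do rewrite mulrBr.
  rewrite big_split /=; apply: lerD.
    exact: (fmax_ge t0 (fun t => \sum_i (-1) ^+ e i * phi t (w.2 i))).
  apply: le_trans (fmax_ge _ _ t); apply: ler_sum => i _.
  by rewrite ffunE signrN mulNr.
have PP f : \sum_w P w.1 * P w.2 * f w.1 = \sum_S P S * f S.
  rewrite -(pair_big xpredT xpredT (fun S S' => P S * P S' * f S)) /=.
  apply: eq_bigr => S _; under eq_bigr do rewrite mulrAC.
  by rewrite -mulr_sumr sum_ffun_prod // mulr1.
have PP' f : \sum_w P w.1 * P w.2 * f w.2 = \sum_S P S * f S.
  rewrite -(pair_big xpredT xpredT (fun S S' => P S * P S' * f S')) exchange_big /=.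
  apply: eq_bigr => S _; under eq_bigr do rewrite -mulrA.
  by rewrite -mulr_suml sum_ffun_prod // mul1r.
have step1 : \sum_(S : {ffun 'I_n -> Z}) (\prod_i p (S i)) *
      \sum_i (\sum_z p z * phi (tau S) z - phi (tau S) (S i)) <=
      \sum_w P w.1 * P w.2 * M e0 w.
  rewrite -(pair_big xpredT xpredT (fun S S' => P S * P S' * M e0 (S, S'))) /=.
  apply: ler_sum => S _; rewrite -/(P S).
  under [leRHS]eq_bigr do rewrite -mulrA.
  rewrite -mulr_sumr ler_wpM2l //.
  have -> : \sum_i (\sum_z p z * phi (tau S) z - phi (tau S) (S i)) =
      \sum_S' P S' * \sum_i (phi (tau S) (S' i) - phi (tau S) (S i)).
    under [RHS]eq_bigr do rewrite mulr_sumr.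
    rewrite exchange_big /=; apply: eq_bigr => i _.
    under [RHS]eq_bigr do rewrite mulrBr.
    rewrite big_split /= sum_ffun_marginal //; congr (_ + _).
    by rewrite sumrN -mulr_suml sum_ffun_prod // mul1r.
  apply: ler_sum => S' _; rewrite ler_wpM2l //.
  apply: le_trans (fmax_ge _ _ (tau S)); apply: ler_sum => i _.
  by rewrite ffunE mul1r.
apply: (@le_trans _ _ (2 ^+ n * \sum_w P w.1 * P w.2 * M e0 w)).
  by rewrite ler_wpM2l // exprn_ge0.
have -> : 2 ^+ n * \sum_w P w.1 * P w.2 * M e0 w =
    \sum_(e : signs) \sum_w P w.1 * P w.2 * M e w.
  under [RHS]eq_bigr do rewrite swapM.
  by rewrite sumr_const card_signs -[RHS]mulr_natl natrX.
apply: (@le_trans _ _ (\sum_(e : signs) (\sum_S P S * A e S + \sum_S P S * A (ng e) S))).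
  apply: ler_sum => e _; rewrite -(PP (A (ng e))) -(PP' (A e)) -big_split /=.
  by apply: ler_sum => w _; rewrite -mulrDr ler_wpM2l // mulr_ge0.
rewrite big_split /=.
have <- : \sum_e \sum_S P S * A e S = \sum_e \sum_S P S * A (ng e) S.
  exact: (reindex_inj (inv_inj ngK)).
rewrite -mulr2n -[leLHS]mulr_natl ler_wpM2l // exchange_big /=.
by apply: ler_sum => S _; rewrite mulr_sumr.
Qed.

(** Take maximisers [t] and [u] of the two left-hand maxima. On the right, test them in this order
    or exchanged, according to the sign of [b t - b u]. *)
Lemma fmax_contraction (a b f : T -> R) :
  (forall t u, `|f t - f u| <= `|b t - b u|) ->
  fmax t0 (fun t => a t + f t) + fmax t0 (fun t => a t - f t) <=
  fmax t0 (fun t => a t + b t) + fmax t0 (fun t => a t - b t).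
Proof.
move=> fb; rewrite {1 2}/fmax; set t := Order.arg_max _ _ _; set u := Order.arg_max _ _ _.
have Ht := fmax_ge t0 (fun t => a t + b t) t.
have Hu := fmax_ge t0 (fun t => a t + b t) u.
have Ht' := fmax_ge t0 (fun t => a t - b t) t.
have Hu' := fmax_ge t0 (fun t => a t - b t) u.
have := le_trans (ler_norm _) (fb t u).
by case: (ger0P (b t - b u)) => ? ?; lra.
Qed.

(* Ledoux-Talagrand, replacing the coordinates one at a time. *)
Lemma rademacher_contraction (phi : 'I_n -> R -> R) (x : T -> 'I_n -> R) :
  (forall i a b, `|phi i a - phi i b| <= `|a - b|) ->
  rademacher_sum (fun t i => phi i (x t i)) <= rademacher_sum x.
Proof.
move=> lip; pose h k t (i : 'I_n) := if (i < k)%N then x t i else phi i (x t i).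
have step k : (k < n)%N -> rademacher_sum (h k) <= rademacher_sum (h k.+1).
  move=> kn; pose i0 := Ordinal kn.
  (* Each sign vector is paired with its flip at [i0], which turns the average over that sign into
     the two-maxima form of [fmax_contraction]. *)
  pose fl (e : signs) : signs := [ffun i => if i == i0 then ~~ e i else e i].
  have flK : involutive fl.
    by move=> e; apply/ffunP => i; rewrite !ffunE; case: eqP => //; rewrite negbK.
  pose F k (e : signs) := fmax t0 (fun t => \sum_i (-1) ^+ e i * h k t i).
  have dbl l : rademacher_sum (h l) = (\sum_e (F l e + F l (fl e))) / 2.
    rewrite big_split /=.
    have <- : \sum_e F l e = \sum_e F l (fl e) by exact: (reindex_inj (inv_inj flK)).
    by rewrite /rademacher_sum -/(F l); field.
  rewrite !dbl ler_pM2r ?invr_gt0 //; apply: ler_sum => e _.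
  pose a t := \sum_(i | i != i0) (-1) ^+ e i * h k t i.
  pose f t := (-1) ^+ e i0 * phi i0 (x t i0).
  pose b t := (-1) ^+ e i0 * x t i0.
  have E1 : F k e = fmax t0 (fun t => a t + f t).
    rewrite /F; congr (fmax t0 _); apply: funext => t.
    by rewrite (bigD1 i0) //= addrC /h ltnn.
  have E2 : F k (fl e) = fmax t0 (fun t => a t - f t).
    rewrite /F; congr (fmax t0 _); apply: funext => t.
    rewrite (bigD1 i0) //= addrC /h ltnn ffunE eqxx signrN mulNr; congr (_ + _).
    by apply: eq_bigr => i /negbTE ii; rewrite ffunE ii.
  have hS t i : i != i0 -> h k.+1 t i = h k t i.
    by move=> ii; rewrite /h ltnS leq_eqVlt -[k in _ == k]/(val i0) val_eqE (negbTE ii).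
  have E3 : F k.+1 e = fmax t0 (fun t => a t + b t).
    rewrite /F; congr (fmax t0 _); apply: funext => t.
    rewrite (bigD1 i0) //= addrC {2}/h ltnSn; congr (_ + _).
    by apply: eq_bigr => i ii; rewrite hS.
  have E4 : F k.+1 (fl e) = fmax t0 (fun t => a t - b t).
    rewrite /F; congr (fmax t0 _); apply: funext => t.
    rewrite (bigD1 i0) //= addrC {2}/h ltnSn ffunE eqxx signrN mulNr; congr (_ + _).
    by apply: eq_bigr => i ii; rewrite hS // ffunE (negbTE ii).
  rewrite E1 E2 E3 E4; apply: fmax_contraction => t u.
  by rewrite -!mulrBr !normrM normr_sign !mul1r.
have H k : (k <= n)%N -> rademacher_sum (h 0%N) <= rademacher_sum (h k).
  elim: k => [//|k IH kn]; apply: (le_trans (IH (ltnW kn))); exact: step.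
have := H n (leqnn n); congr (_ <= _).
rewrite /rademacher_sum; apply: eq_bigr => e _; congr (fmax t0 _); apply: funext => t.
by apply: eq_bigr => i _; rewrite /h ltn_ord.
Qed.

(** The generous exponent allows an elementary proof: [expR y <= (1 - y)^-1] for small arguments,
    and [|x| <= 2 * x ^+ 2] beyond 1/2. *)
Lemma cosh_le (x : R) : expR x + expR (- x) <= 2 * expR (2 * x ^+ 2).
Proof.
case: (lerP `|x| (1 / 2)) => [|xh].
  rewrite ler_norml => /andP[x1 x2].
  have inv_le (y : R) : y <= 1 / 2 -> expR y <= (1 - y)^-1.
    move=> y1; rewrite -[y in expR y]opprK expRN lef_pV2 ?posrE ?expR_gt0 //; last by lra.
    exact: expR_ge1Dx.
  have H1 := inv_le x x2; have H2 := inv_le (- x) ltac:(lra); rewrite opprK in H2.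
  have E : (1 - x)^-1 + (1 + x)^-1 = 2 / (1 - x ^+ 2).
    by field; apply/andP; split; [|apply/andP; split]; rewrite gt_eqF //; nra.
  have D0 : 0 < 1 - x ^+ 2 by nra.
  have : 2 / (1 - x ^+ 2) <= 2 * (1 + 2 * x ^+ 2).
    rewrite ler_pdivrMr //.
    have : x ^+ 2 <= 1 / 2 by nra.
    have : 0 <= x ^+ 2 by exact: sqr_ge0.
    by move: (x ^+ 2) => y; nra.
  have := expR_ge1Dx (2 * x ^+ 2).
  by lra.
have : `|x| <= 2 * x ^+ 2 by rewrite -real_normK ?num_real //; nra.
rewrite ler_norml => /andP[x1 x2].
have : expR x <= expR (2 * x ^+ 2) by rewrite ler_expR.
have : expR (- x) <= expR (2 * x ^+ 2) by rewrite ler_expR; lra.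
by lra.
Qed.

Lemma sum_signs_expR (c : 'I_n -> R) (l : R) : (forall i, c i ^+ 2 = 1) ->
  \sum_(e : signs) expR (l * \sum_i (-1) ^+ e i * c i) <=
  2 ^+ n * expR (2 * l ^+ 2 * n%:R).
Proof.
move=> c1.
have -> : \sum_(e : signs) expR (l * \sum_i (-1) ^+ e i * c i) =
    \prod_i (expR (l * c i) + expR (- (l * c i))).
  transitivity (\sum_(e : signs) \prod_i expR (l * ((-1) ^+ e i * c i))).
    by apply: eq_bigr => e _; rewrite mulr_sumr expR_sum.
  rewrite -(bigA_distr_bigA (fun i (b : bool) => expR (l * ((-1) ^+ b * c i)))) /=.
  apply: eq_bigr => i _; rewrite big_bool /= expr1 mul1r mulN1r mulrN addrC.
  by rewrite ?expr0 ?mul1r.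
rewrite expRM_natr -exprMn.
have -> : (2 * expR (2 * l ^+ 2)) ^+ n = \prod_(i < n) (2 * expR (2 * l ^+ 2)).
  by rewrite prodr_const card_ord.
apply: ler_prod => i _; rewrite addr_ge0 ?expR_ge0 //=.
by have := cosh_le (l * c i); rewrite exprMn c1 mulr1.
Qed.

Lemma massart (c : T -> 'I_n -> R) (d : nat) (l : R) :
  0 < l -> (#|T| <= 2 ^ d)%N -> (forall t i, c t i ^+ 2 = 1) ->
  rademacher_sum c <= 2 ^+ n * (d%:R / l + 2 * l * n%:R).
Proof.
move=> l0 Td c1; set a := d%:R / l + _.
have la : l * a = d%:R + 2 * l ^+ 2 * n%:R.
  by rewrite /a; field; rewrite gt_eqF.
pose Q (e : signs) t := \sum_i (-1) ^+ e i * c t i.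
(* The tangent inequality [1 + y <= expR y] at [y = l * (Q e t - a)] linearizes the log-sum-exp
   bound. The value of [a] makes the averaged exponential sum at most 1, which cancels [- l^-1]. *)
have H1 e : fmax t0 (Q e) <= a - l^-1 + l^-1 * \sum_t expR (l * Q e t) * expR (- (l * a)).
  apply: fmax_le => t.
  apply: (@le_trans _ _ (a - l^-1 + l^-1 * (expR (l * Q e t) * expR (- (l * a))))); last first.
    rewrite lerD2l ler_pM2l ?invr_gt0 // (bigD1 t) //= lerDl.
    by rewrite sumr_ge0 // => u _; rewrite mulr_ge0 ?expR_ge0.
  rewrite -expRD; have := expR_ge1Dx (l * Q e t + - (l * a)) => H.
  apply: (@le_trans _ _ (a - l^-1 + l^-1 * (1 + (l * Q e t + - (l * a))))).
    by rewrite [leRHS](_ : _ = Q e t) //; field; rewrite gt_eqF.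
  by rewrite lerD2l ler_pM2l ?invr_gt0.
apply: (le_trans (ler_sum _ (fun e _ => H1 e))).
rewrite big_split /= sumr_const card_signs -mulr_sumr exchange_big /=.
have H2 : \sum_t \sum_(e : signs) expR (l * Q e t) * expR (- (l * a)) <= 2 ^+ n.
  apply: (@le_trans _ _ (\sum_(t : T) 2 ^+ n * expR (- d%:R))).
    apply: ler_sum => t _; rewrite -mulr_suml.
    apply: (@le_trans _ _ (2 ^+ n * expR (2 * l ^+ 2 * n%:R) * expR (- (l * a)))).
      by rewrite ler_wpM2r ?expR_ge0 // sum_signs_expR.
    by rewrite -mulrA -expRD la opprD addrCA subrr addr0.
  rewrite sumr_const -[leLHS]mulr_natr -mulrA -[leRHS]mulr1 ler_wpM2l ?exprn_ge0 //.
  rewrite expRN mulrC ler_pdivrMr ?expR_gt0 // mul1r.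
  apply: (@le_trans _ _ (2 ^+ d)); first by rewrite -natrX ler_nat.
  rewrite -[d%:R]mulr1 expRM_natl.
  apply: lerXn2r; rewrite ?nnegrE ?expR_ge0 //.
  by have := expR_ge1Dx (1 : R).
rewrite -[X in X + _ <= _]mulr_natl natrX.
have : l^-1 * \sum_t \sum_(e : signs) expR (l * Q e t) * expR (- (l * a)) <= l^-1 * 2 ^+ n.
  by rewrite ler_pM2l ?invr_gt0.
by rewrite mulrBr (mulrC l^-1 (2 ^+ n)); lra.
Qed.

End Rademacher.

(** The signed sum is the pairing of [X t] with the matrix [G e] that collects the signs falling on
    each entry. Grothendieck's inequality costs the factor 8 and leaves a maximum over sign pairs
    for Massart's lemma. *)
Lemma rademacher_max_norm_ball (T : finType) (t0 : T) (n m1 m2 : nat)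
    (X : T -> 'M[R]_(m1, m2)) (w : 'I_n -> 'I_m1 * 'I_m2) (B : R) :
  (0 < n)%N -> (0 < m1)%N -> 0 <= B -> (forall t, max_norm (X t) <= B) ->
  rademacher_sum t0 (fun t i => X t (w i).1 (w i).2) <=
  2 ^+ n * (24 * B * Num.sqrt (n%:R * (m1 + m2)%:R)).
Proof.
move=> n0 m0 B0 XB.
pose K := ({ffun 'I_m1 -> bool} * {ffun 'I_m2 -> bool})%type.
pose k0 : K := ([ffun=> false], [ffun=> false]).
pose c (s : K) (i : 'I_n) : R := (-1) ^+ s.1 (w i).1 * (-1) ^+ s.2 (w i).2.
pose G (e : {ffun 'I_n -> bool}) : 'M[R]_(m1, m2) :=
  \matrix_(a, b) \sum_i (-1) ^+ e i * ((w i).1 == a)%:R * ((w i).2 == b)%:R.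
have dotG e (f : 'I_m1 -> 'I_m2 -> R) :
    \sum_a \sum_b G e a b * f a b = \sum_i (-1) ^+ e i * f (w i).1 (w i).2.
  transitivity (\sum_a \sum_b \sum_i
      (-1) ^+ e i * ((w i).1 == a)%:R * ((w i).2 == b)%:R * f a b).
    by apply: eq_bigr => a _; apply: eq_bigr => b _; rewrite mxE mulr_suml.
  under eq_bigr do rewrite exchange_big.
  rewrite exchange_big /=; apply: eq_bigr => i _.
  rewrite (bigD1 (w i).1) //= (bigD1 (w i).2) //= !eqxx !mulr1.
  rewrite !big1 ?addr0 // => [a /negbTE ai|b /negbTE bi].
    by rewrite big1 // => b _; rewrite eq_sym ai mulr0 !mul0r.
  by rewrite eq_sym bi mulr0 mul0r.
have sG e : sign_norm (G e) = fmax k0 (fun s => \sum_i (-1) ^+ e i * c s i).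
  by rewrite /sign_norm; congr (fmax _ _); apply: funext => s; rewrite dotG.
apply: (@le_trans _ _ (8 * B * rademacher_sum k0 c)).
  rewrite mulr_sumr; apply: ler_sum => e _; apply: fmax_le => t.
  by rewrite -(dotG e (X t)) -sG mxdot_le_max_norm.
pose q : R := Num.sqrt (n%:R * (m1 + m2)%:R).
have nR : 0 < n%:R :> R by rewrite ltr0n.
have dR : 0 < (m1 + m2)%:R :> R by rewrite ltr0n addn_gt0 m0.
have q0 : 0 < q by rewrite sqrtr_gt0 mulr_gt0.
have q2 : q * q = n%:R * (m1 + m2)%:R by rewrite -expr2 sqr_sqrtr // mulr_ge0.
(* This value of the parameter in Massart's lemma makes its two terms [2 * q] and [q], of the same
   order. *)
have l0 : 0 < q / (2 * n%:R) by rewrite divr_gt0 // mulr_gt0.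
have cK : (#|{: K}| <= 2 ^ (m1 + m2))%N.
  by rewrite card_prod !card_ffun !card_bool !card_ord expnD.
have c1 s i : c s i ^+ 2 = 1 by rewrite exprMn !sqrr_sign mulr1.
have := massart k0 l0 cK c1.
have -> : (m1 + m2)%:R / (q / (2 * n%:R)) + 2 * (q / (2 * n%:R)) * n%:R = 3 * q.
  have -> : (m1 + m2)%:R = q * q / n%:R by rewrite q2 mulrAC divff ?mul1r ?gt_eqF.
  by field; rewrite !gt_eqF.
move=> H; apply: (@le_trans _ _ (8 * B * (2 ^+ n * (3 * q)))).
  by rewrite ler_wpM2l // mulr_ge0.
by rewrite [leLHS](_ : _ = 2 ^+ n * (24 * B * q)) //; ring.
Qed.

End EmpiricalProcess.

(** * The logistic loss and the Hellinger comparison *)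

Section Logistic.
Variable R : realType.

Lemma logistic_gt0 (x : R) : 0 < logistic x.
Proof. by rewrite divr_gt0 ?expR_gt0 // addr_gt0 ?expR_gt0. Qed.

Lemma onem_logistic (x : R) : 1 - logistic x = (1 + expR x)^-1.
Proof.
have : 0 < 1 + expR x by rewrite addr_gt0 ?expR_gt0.
by move=> ?; rewrite /logistic; field; rewrite gt_eqF.
Qed.

Lemma onem_logistic_gt0 (x : R) : 0 < 1 - logistic x.
Proof. by rewrite onem_logistic invr_gt0 addr_gt0 ?expR_gt0. Qed.

Lemma logisticN (x : R) : logistic (- x) = 1 - logistic x.
Proof.
rewrite onem_logistic /logistic expRN; have := expR_gt0 x => x0.
by field; rewrite !gt_eqF // addr_gt0.
Qed.

Lemma logistic_ge_half (x : R) : (2^-1 <= logistic x) = (0 <= x).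
Proof.
have x0 := expR_gt0 x; rewrite /logistic ler_pdivlMr ?addr_gt0 //.
rewrite -expR0 -[RHS]ler_expR expR0.
by apply/idP/idP => ?; lra.
Qed.

(** Both losses are [ln (1 + expR u)] with [u] the argument up to sign, and [1 + expR u <= expR (u -
    v) * (1 + expR v)] whenever [v <= u]. *)
Lemma logistic_loss_lipschitz (y : bool) (a b : R) :
  `|- ln (if y then logistic a else 1 - logistic a) -
    - ln (if y then logistic b else 1 - logistic b)| <= `|a - b|.
Proof.
have D0 (x : R) : 0 < 1 + expR x by rewrite addr_gt0 ?expR_gt0.
have main (u v : R) : `|ln (1 + expR u) - ln (1 + expR v)| <= `|u - v|.
  wlog uv : u v / v <= u => [H|].
    case: (leP v u) => [|/ltW] /H //.
    by rewrite distrC (distrC v).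
  have H1 : ln (1 + expR v) <= ln (1 + expR u).
    by rewrite ler_ln ?posrE // lerD2l ler_expR.
  rewrite !ger0_norm ?subr_ge0 // lerBlDr -[u - v]expRK -lnM ?posrE ?expR_gt0 //.
  rewrite ler_ln ?posrE ?mulr_gt0 ?expR_gt0 // mulrDr mulr1 -expRD subrK lerD2r.
  by rewrite -expR0 ler_expR subr_ge0.
have E (x : R) : - ln (1 - logistic x) = ln (1 + expR x).
  by rewrite onem_logistic lnV ?posrE // opprK.
case: y; last by rewrite !E.
have E' (x : R) : - ln (logistic x) = ln (1 + expR (- x)).
  by rewrite -E logisticN subKr.
rewrite !E'; apply: (le_trans (main _ _)).
by rewrite opprK addrC distrC.
Qed.

(* Each term satisfies [a ln (a / b) >= 2 a - 2 sqrt (a b)], because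
   [ln x <= x - 1] at [x = sqrt (b / a)]; this is the comparison with the
   squared Hellinger distance. *)
Lemma mul_ln_ratio_ge (a b : R) : 0 < a -> 0 < b ->
  2 * a - 2 * (Num.sqrt a * Num.sqrt b) <= a * (ln a - ln b).
Proof.
move=> a0 b0; set s := Num.sqrt a; set t := Num.sqrt b.
have s0 : 0 < s by rewrite sqrtr_gt0.
have t0 : 0 < t by rewrite sqrtr_gt0.
have sa : a = s * s by rewrite -expr2 sqr_sqrtr // ltW.
have tb : b = t * t by rewrite -expr2 sqr_sqrtr // ltW.
have H : ln t - ln s <= t / s - 1.
  rewrite -ln_div ?posrE //; have ts : 0 < t / s by rewrite divr_gt0.
  rewrite -[X in ln X](subrKC 1); apply: le_ln1Dx; lra.
have : s * s * (ln t - ln s) <= s * s * (t / s - 1) by rewrite ler_pM2l // mulr_gt0.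
have -> : s * s * (t / s - 1) = s * t - s * s by field; rewrite gt_eqF.
rewrite sa tb !lnM ?posrE //; lra.
Qed.

(** The divergence dominates the squared Hellinger distance. Each of its two terms is at least a
    quarter of [(p - q) ^+ 2], because the square roots sum to at most 2. *)
Lemma binary_kl_ge (p q : R) : 0 < p -> 0 < 1 - p -> 0 < q -> 0 < 1 - q ->
  (p - q) ^+ 2 / 2 <=
  p * (ln p - ln q) + (1 - p) * (ln (1 - p) - ln (1 - q)).
Proof.
move=> p0 p1 q0 q1.
have H1 := mul_ln_ratio_ge p0 q0; have H2 := mul_ln_ratio_ge p1 q1.
have hel (a b : R) : 0 < a -> 0 < b -> a <= 1 -> b <= 1 ->
    (a - b) ^+ 2 / 4 <= a + b - 2 * (Num.sqrt a * Num.sqrt b).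
  move=> a0 b0 a1 b1; set s := Num.sqrt a; set t := Num.sqrt b.
  have sa : a = s ^+ 2 by rewrite sqr_sqrtr // ltW.
  have tb : b = t ^+ 2 by rewrite sqr_sqrtr // ltW.
  have s1 : s <= 1 by rewrite -sqrtr1 ler_wsqrtr.
  have t1 : t <= 1 by rewrite -sqrtr1 ler_wsqrtr.
  have s0 : 0 <= s by rewrite sqrtr_ge0.
  have t0 : 0 <= t by rewrite sqrtr_ge0.
  have -> : a + b - 2 * (s * t) = (s - t) ^+ 2 by rewrite sa tb; ring.
  have -> : (a - b) ^+ 2 / 4 = (s - t) ^+ 2 * ((s + t) / 2) ^+ 2.
    by rewrite sa tb; field.
  by rewrite ler_piMr ?sqr_ge0 // expr_le1 //; lra.
have H3 := hel p q p0 q0 ltac:(lra) ltac:(lra).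
have H4 := hel (1 - p) (1 - q) p1 q1 ltac:(lra) ltac:(lra).
have E : (1 - p - (1 - q)) ^+ 2 = (p - q) ^+ 2 by ring.
rewrite E in H4; lra.
Qed.

End Logistic.

(** * Excess risk, excess log-loss and the maximum likelihood estimator *)

Section Excess.
Variables (R : realType) (m1 m2 : nat).
Implicit Type X : 'M[R]_(m1, m2).

Lemma label_prob_gt0 X w y : 0 < label_prob X w y.
Proof. by case: y; rewrite /= ?logistic_gt0 ?onem_logistic_gt0. Qed.

Definition obs_prob X (z : ('I_m1 * 'I_m2) * bool) : R :=
  (m1 * m2)%:R^-1 * label_prob X z.1 z.2.

Definition log_loss X (z : ('I_m1 * 'I_m2) * bool) : R :=
  - ln (label_prob X z.1 z.2).

Lemma obs_sum X (F : ('I_m1 * 'I_m2) * bool -> R) :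
  \sum_z obs_prob X z * F z =
  (m1 * m2)%:R^-1 * \sum_w (logistic (X w.1 w.2) * F (w, true) +
    (1 - logistic (X w.1 w.2)) * F (w, false)).
Proof.
transitivity (\sum_w \sum_y obs_prob X (w, y) * F (w, y)).
  by rewrite pair_big /=; apply: eq_bigr => -[].
rewrite mulr_sumr; apply: eq_bigr => w _.
by rewrite big_bool /= /obs_prob /=; ring.
Qed.

Lemma obs_prob_sum1 X : (0 < m1)%N -> (0 < m2)%N -> \sum_z obs_prob X z = 1.
Proof.
move=> m10 m20; under eq_bigr do rewrite -[obs_prob _ _]mulr1.
rewrite obs_sum; under eq_bigr do rewrite !mulr1 subrKC.
rewrite sumr_const card_prod !card_ord mulVf // pnatr_eq0 -lt0n.
by rewrite muln_gt0 m10.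
Qed.

Lemma low_noise_margin X (c : R) : (0 < m1)%N -> (0 < m2)%N -> low_noise X c ->
  forall w : 'I_m1 * 'I_m2,
  logistic (X w.1 w.2) = 2^-1 \/ (2 * c)^-1 <= `|logistic (X w.1 w.2) - 2^-1|.
Proof.
move=> m10 m20 + w; rewrite /low_noise /unif_prob => /eqP.
have m0 : (m1 * m2)%:R != 0 :> R by rewrite pnatr_eq0 -lt0n muln_gt0 m10.
rewrite mulf_eq0 invr_eq0 (negbTE m0) orbF pnatr_eq0 cards_eq0.
move=> /eqP/setP/(_ w); rewrite !inE.
move=> /negbT; rewrite negb_and -leNgt -leNgt normr_le0 subr_eq0.
by case/orP => [/eqP|]; [left|right].
Qed.

(** Entry by entry, a wrong sign costs [2 * u] with [u = |p - 1/2|]. The margin gives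
    [2 * u <= 4 * c * u ^+ 2], and [u <= |p - q|] because 1/2 separates [p] and [q]. *)
Lemma excess_risk_le X Xh (c : R) : (0 < m1)%N -> (0 < m2)%N -> 0 < c ->
  low_noise X c ->
  risk X (sign_cls Xh) - risk X (bayes X) <=
  8 * c * (\sum_z obs_prob X z * log_loss Xh z - \sum_z obs_prob X z * log_loss X z).
Proof.
move=> m10 m20 c0 LN; rewrite !obs_sum -!mulrBr -!sumrB mulrCA.
rewrite ler_wpM2l ?invr_ge0 // mulr_sumr; apply: ler_sum => w _.
set p := logistic (X w.1 w.2); set q := logistic (Xh w.1 w.2).
have p0 : 0 < p := logistic_gt0 _; have q0 : 0 < q := logistic_gt0 _.
have p1 : 0 < 1 - p := onem_logistic_gt0 _; have q1 : 0 < 1 - q := onem_logistic_gt0 _.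
apply: (@le_trans _ _ (8 * c * ((p - q) ^+ 2 / 2))); last first.
  rewrite ler_wpM2l ?mulr_ge0 ?(ltW c0) //.
  apply: (le_trans (binary_kl_ge p0 p1 q0 q1)).
  by rewrite /log_loss /= -/p -/q; lra.
have marg : logistic (X w.1 w.2) = 2^-1 \/ (2 * c)^-1 <= `|p - 2^-1| :=
  low_noise_margin m10 m20 LN w.
rewrite -/p in marg.
have marg' (u : R) : `|p - 2^-1| = u -> 2 * u <= 4 * c * u ^+ 2.
  move=> pu; case: marg => [p2|]; first by rewrite -pu p2 subrr normr0; lra.
  rewrite pu -div1r ler_pdivrMr ?mulr_gt0 // => H.
  have u0 : 0 <= u by rewrite -pu.
  by nra.
have ge0 : 0 <= 8 * c * ((p - q) ^+ 2 / 2).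
  by rewrite mulr_ge0 ?divr_ge0 ?sqr_ge0 // mulr_ge0 // ltW.
rewrite /bayes /sign_cls -!logistic_ge_half -/p -/q.
have [ph|ph] := leP 2^-1 p; have [qh|qh] := leP 2^-1 q => /=; rewrite -/p.
- by rewrite subrr.
- have := marg' (p - 2^-1); rewrite ger0_norm ?subr_ge0 // => /(_ erefl) H.
  have : (p - 2^-1) ^+ 2 <= (p - q) ^+ 2 by rewrite ler_sqr ?nnegrE; lra.
  by nra.
- have := marg' (2^-1 - p); rewrite distrC ger0_norm ?subr_ge0 ?(ltW ph) // => /(_ erefl) H.
  have : (2^-1 - p) ^+ 2 <= (q - p) ^+ 2 by rewrite ler_sqr ?nnegrE; lra.
  have -> : (q - p) ^+ 2 = (p - q) ^+ 2 by ring.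
  by nra.
- by rewrite subrr.
Qed.

(** The class in the Rademacher sum is indexed by the samples themselves through [Xhat], with the
    identity as data-dependent choice; this keeps it finite. *)
Lemma expected_log_loss_le n X (Xhat : sample m1 m2 n -> 'M[R]_(m1, m2)) (B : R) :
  (0 < m1)%N -> (0 < m2)%N -> (0 < n)%N -> 0 <= B ->
  (forall S, max_norm (Xhat S) <= B) ->
  (forall S, loglik S X <= loglik S (Xhat S)) ->
  \sum_S sample_prob X S * (\sum_z obs_prob X z * log_loss (Xhat S) z -
    \sum_z obs_prob X z * log_loss X z) <=
  48 * B * (Num.sqrt (n%:R * (m1 + m2)%:R) / n%:R).
Proof.
move=> m10 m20 n0 B0 XB mle; set L := fun Y => \sum_z obs_prob X z * log_loss Y z.
have p0 z : 0 <= obs_prob X z.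
  by rewrite mulr_ge0 ?invr_ge0 // ltW // label_prob_gt0.
have p1 : \sum_z obs_prob X z = 1 := obs_prob_sum1 X m10 m20.
have nR : 0 < n%:R :> R by rewrite ltr0n.
have P0 S : 0 <= sample_prob X S by apply: prodr_ge0 => i _; exact: (p0 (S i)).
have loglikE S Y : loglik S Y = - \sum_i log_loss Y (S i).
  rewrite -sumrN; apply: eq_bigr => i _; rewrite /log_loss opprK /label_prob.
  by case: (S i).2.
pose S0 : sample m1 m2 n := [ffun=> ((Ordinal m10, Ordinal m20), true)].
have Psum : \sum_(S : sample m1 m2 n) sample_prob X S = 1 :=
  sum_ffun_prod n p1.
have sym := symmetrization S0 (fun S z => log_loss (Xhat S) z) id p0 p1.
have rad (S : sample m1 m2 n) : rademacher_sum S0 (fun t i => log_loss (Xhat t) (S i)) <=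
    2 ^+ n * (24 * B * Num.sqrt (n%:R * (m1 + m2)%:R)).
  apply: le_trans (rademacher_max_norm_ball S0 (fun i => (S i).1) n0 m10 B0 XB).
  apply: (rademacher_contraction S0
    (phi := fun i x => - ln (if (S i).2 then logistic x else 1 - logistic x))).
  by move=> i a b; exact: logistic_loss_lipschitz.
set Q := Num.sqrt _ in rad *.
have upper : \sum_(S : sample m1 m2 n) sample_prob X S *
    \sum_i (L (Xhat S) - log_loss (Xhat S) (S i)) <= 48 * B * Q.
  rewrite -(ler_pM2l (exprn_gt0 n (ltr0Sn R 1))); apply: (le_trans sym).
  apply: (@le_trans _ _ (2 * \sum_(S : sample m1 m2 n) sample_prob X S *
      (2 ^+ n * (24 * B * Q)))).
    by rewrite ler_pM2l //; apply: ler_sum => S _; rewrite ler_wpM2l // P0.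
  rewrite -mulr_suml Psum mul1r le_eqVlt; apply/predU1P; left; ring.
(* The empirical loss of [X] has mean [n%:R * L X], and the estimator has no larger empirical loss
   on any sample. *)
have lower : n%:R * \sum_S sample_prob X S * (L (Xhat S) - L X) <=
    \sum_(S : sample m1 m2 n) sample_prob X S *
    \sum_i (L (Xhat S) - log_loss (Xhat S) (S i)).
  have EX : \sum_(S : sample m1 m2 n) sample_prob X S * \sum_i log_loss X (S i) =
      n%:R * L X.
    under eq_bigr do rewrite mulr_sumr.
    rewrite exchange_big /= mulr_natl -[n in _ *+ n]card_ord -sumr_const.
    by apply: eq_bigr => i _; exact: sum_ffun_marginal.
  have -> : n%:R * \sum_S sample_prob X S * (L (Xhat S) - L X) =
     \sum_(S : sample m1 m2 n) sample_prob X S *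
      (n%:R * L (Xhat S) - \sum_i log_loss X (S i)).
    under [RHS]eq_bigr do rewrite mulrBr mulrCA.
    rewrite big_split /= sumrN EX -mulr_sumr -mulrBr; congr (_ * _).
    under eq_bigr do rewrite mulrBr.
    by rewrite sumrB -mulr_suml Psum mul1r.
  apply: ler_sum => S _; rewrite ler_wpM2l //.
  rewrite sumrB sumr_const card_ord mulr_natl lerD2l lerN2.
  by have := mle S; rewrite !loglikE lerN2.
by rewrite mulrA ler_pdivlMr // mulrC; exact: le_trans lower upper.
Qed.

End Excess.

Theorem theorem2 (R : realType) (gamma c : R) (hgamma : 0 < gamma) (hc : 0 < c) :
  exists C : R, 0 < C /\
  forall (m1 m2 n : nat) (Xs : 'M[R]_(m1, m2))
         (Xhat : sample m1 m2 n -> 'M[R]_(m1, m2)),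
    (0 < m1)%N -> (0 < m2)%N -> (0 < n)%N ->
    low_noise Xs c ->
    norm_inf Xs <= gamma ->
    (forall S : sample m1 m2 n, @Kmax R m1 m2 gamma (\rank Xs)%:R (Xhat S) /\
       forall X : 'M[R]_(m1, m2), @Kmax R m1 m2 gamma (\rank Xs)%:R X -> loglik S X <= loglik S (Xhat S)) ->
    excess Xs (fun S => sign_cls (Xhat S))
      <= C * Num.sqrt ((\rank Xs)%:R * (m1 + m2)%:R / n%:R).
Proof.
(* The product of [8 * c] from the risk comparison and [48 * gamma] from the deviation bound. *)
exists (384 * c * gamma); split; first by rewrite !mulr_gt0.
move=> m1 m2 n Xs Xhat m10 m20 n0 LN Xg HX.
have XsK : Kmax gamma (\rank Xs)%:R Xs by split => //; exact: max_norm_le_rank.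
have nR : 0 < n%:R :> R by rewrite ltr0n.
have B0 : 0 <= gamma * Num.sqrt (\rank Xs)%:R by rewrite mulr_ge0 ?sqrtr_ge0 // ltW.
have XB S : max_norm (Xhat S) <= gamma * Num.sqrt (\rank Xs)%:R by case: (HX S) => -[].
have mle S : loglik S Xs <= loglik S (Xhat S) by case: (HX S) => _; exact.
have KL := expected_log_loss_le m10 m20 n0 B0 XB mle.
have Psum : \sum_(S : sample m1 m2 n) sample_prob Xs S = 1 :=
  sum_ffun_prod n (obs_prob_sum1 Xs m10 m20).
have P0 S : 0 <= sample_prob Xs S.
  by apply: prodr_ge0 => i _; rewrite mulr_ge0 ?invr_ge0 // ltW // label_prob_gt0.
have -> : excess Xs (fun S => sign_cls (Xhat S)) =
    \sum_(S : sample m1 m2 n) sample_prob Xs S *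
      (risk Xs (sign_cls (Xhat S)) - risk Xs (bayes Xs)).
  under [RHS]eq_bigr do rewrite mulrBr.
  by rewrite sumrB -mulr_suml Psum mul1r.
apply: (@le_trans _ _ (8 * c * \sum_(S : sample m1 m2 n) sample_prob Xs S *
    (\sum_z obs_prob Xs z * log_loss (Xhat S) z - \sum_z obs_prob Xs z * log_loss Xs z))).
  rewrite mulr_sumr; apply: ler_sum => S _; rewrite mulrCA ler_wpM2l //.
  exact: excess_risk_le.
apply: (@le_trans _ _ (8 * c * (48 * (gamma * Num.sqrt (\rank Xs)%:R) *
    (Num.sqrt (n%:R * (m1 + m2)%:R) / n%:R)))).
  by rewrite ler_wpM2l // mulr_ge0 // ltW.
have -> : Num.sqrt ((\rank Xs)%:R * (m1 + m2)%:R / n%:R) =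
    Num.sqrt (\rank Xs)%:R * (Num.sqrt (n%:R * (m1 + m2)%:R) / n%:R) :> R.
  rewrite -mulrA [LHS]sqrtrM ?ler0n //; congr (_ * _).
  have -> : (m1 + m2)%:R / n%:R = n%:R * (m1 + m2)%:R / n%:R ^+ 2 :> R.
    by field; rewrite gt_eqF.
  by rewrite [LHS]sqrtrM ?mulr_ge0 // sqrtrV ?exprn_ge0 // sqrtr_sqr ger0_norm.
by rewrite le_eqVlt; apply/predU1P; left; ring.
Qed.
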